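(* For every integer $n\geq 4$ there are infinitely many pairwise non-similar primitive $n_3$-clusters.
   Context: An integral point set in $\mathbb{R}^d$ is a finite subset of $\mathbb{R}^d$ that is full-dimensional (it affinely spans $\mathbb{R}^d$) and has all pairwise Euclidean distances integral. A set $P\subset\mathbb{R}^d$ is in general position if every $d+1$ distinct points of $P$ are affinely independent and no $d+2$ distinct points of $P$ lie on a common sphere. An $n_d$-cluster is an $n$-point integral point set in $\mathbb{R}^d$ in general position that admits a realization in $\mathbb{Z}^d$ (i.e. is congruent to a subset of $\mathbb{Z}^d$). A finite integral point set is primitive if the greatest common divisor of its nonzero pairwise distances is $1$. Two finite point sets in $\mathbb{R}^d$ are similar if one is the image of the other (as an unlabeled set) under a similarity of $\mathbb{R}^d$. *)

(* Defs.v *)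
From HB Require Import structures.
From mathcomp Require Import all_boot all_order all_algebra finmap.
From mathcomp Require Import all_classical all_reals.

Set Implicit Arguments.
Unset Strict Implicit.
Unset Printing Implicit Defensive.

Import Order.TTheory GRing.Theory Num.Theory.
Local Open Scope ring_scope.

(* The norm that MathComp-Analysis puts on 'rV[R]_d is the sup norm, so the
   Euclidean distance has to be introduced separately. *)
Definition edist (R : realType) (d : nat) (x y : 'rV[R]_d) : R :=
  Num.sqrt (\sum_(i < d) (x 0 i - y 0 i) ^+ 2).

Definition affinely_independent (R : realType) (d : nat)
    (Q : {fset 'rV[R]_d}) : Prop :=
  forall c : 'rV[R]_d -> R,
    \sum_(p <- Q) c p = 0 -> \sum_(p <- Q) c p *: p = 0 ->
    forall p, p \in Q -> c p = 0.

Definition affinely_spans (R : realType) (d : nat)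
    (P : {fset 'rV[R]_d}) : Prop :=
  forall x : 'rV[R]_d, exists c : 'rV[R]_d -> R,
    \sum_(p <- P) c p = 1 /\ \sum_(p <- P) c p *: p = x.

Definition on_common_sphere (R : realType) (d : nat)
    (Q : {fset 'rV[R]_d}) : Prop :=
  exists (z : 'rV[R]_d) (r : R),
    0 < r /\ forall p, p \in Q -> edist p z = r.

Definition integral_point_set (R : realType) (d : nat)
    (P : {fset 'rV[R]_d}) : Prop :=
  affinely_spans P /\
  (forall x y, x \in P -> y \in P -> edist x y \is a Num.int).

Definition general_position (R : realType) (d : nat)
    (P : {fset 'rV[R]_d}) : Prop :=
  (forall Q : {fset 'rV[R]_d},
     (Q `<=` P)%fset -> #|` Q|%fset = d.+1 -> affinely_independent Q) /\
  (forall Q : {fset 'rV[R]_d},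
     (Q `<=` P)%fset -> #|` Q|%fset = d.+2 -> ~ on_common_sphere Q).

(* A map scaling all distances by r > 0 is automatically a bijection of R^d. *)
Definition is_similarity (R : realType) (d : nat)
    (f : 'rV[R]_d -> 'rV[R]_d) : Prop :=
  exists r : R, 0 < r /\ forall x y, edist (f x) (f y) = r * edist x y.

Definition is_isometry (R : realType) (d : nat)
    (f : 'rV[R]_d -> 'rV[R]_d) : Prop :=
  forall x y, edist (f x) (f y) = edist x y.

Definition are_similar (R : realType) (d : nat) (P Q : {fset 'rV[R]_d}) : Prop :=
  exists f : 'rV[R]_d -> 'rV[R]_d,
    is_similarity f /\ [fset f x | x in P]%fset = Q.

Definition are_congruent (R : realType) (d : nat) (P Q : {fset 'rV[R]_d}) : Prop :=
  exists f : 'rV[R]_d -> 'rV[R]_d,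
    is_isometry f /\ [fset f x | x in P]%fset = Q.

Definition in_integer_lattice (R : realType) (d : nat)
    (P : {fset 'rV[R]_d}) : Prop :=
  forall p, p \in P -> forall i : 'I_d, p 0 i \is a Num.int.

Definition cluster (R : realType) (n d : nat) (P : {fset 'rV[R]_d}) : Prop :=
  [/\ #|` P|%fset = n,
      integral_point_set P,
      general_position P
    & exists Q : {fset 'rV[R]_d}, are_congruent P Q /\ in_integer_lattice Q].

(* On an integral point set every distance is a natural number, so Num.truncn
   only retypes it; primitive is meaningful for integral point sets only. *)
Definition distance_gcd (R : realType) (d : nat) (P : {fset 'rV[R]_d}) : nat :=
  \big[gcdn/0%N]_(x <- P) \big[gcdn/0%N]_(y <- P | edist x y != 0)
    Num.truncn (edist x y).

Definition primitive (R : realType) (d : nat) (P : {fset 'rV[R]_d}) : Prop :=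
  distance_gcd P = 1%N.

(* Main.v *)
Require Import Defs.
From mathcomp Require Import all_boot all_order all_algebra finmap.
From mathcomp Require Import all_classical all_reals.
From mathcomp Require Import ring lra.
From mathcomp Require Import polyrcf.

(** The space curve
      x(t) = t - 8t/(1+t^2),   y(t) + i z(t) = 8(t+i)/(t-i)^2
    has the chord length
      |t - s| (1 + 8(st+3)/((1+s^2)(1+t^2)))     for s, t >= 0,
    so its points with rational parameter are at rational distances from one
    another.  It is the stereographic image of a torus knot
    (2 exp(2iu), exp(3iu)) on a 3-sphere, whose squared chords are
    4 sin^2(v) (1 + 4 cos^2(v))^2 with v half the difference of the
    parameters; the centre of projection lies on the knot, and the projected
    chords are then rational functions of the tangents of the half angles.

    The curve lies on no plane and on no sphere: on it, an affine function of
    (x, y, z, x^2+y^2+z^2) that is not identically zero becomes a nonzero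
    polynomial over (1+t^2)^2 (affine_form_curve).  Points with large
    parameters can therefore be added one at a time while no four become
    coplanar and no five cospherical (linearly_general_extend, applied to the
    curve and to its lift to the paraboloid in dimension 4).

    The points taken have parameter t = 2k, for k in a finite set T of natural
    numbers containing 0, 1, 2 for which the integers 1 + 4k^2 are pairwise
    coprime (a new k is a multiple of the product M of the old 1 + 4k^2).
    Scaled by M/2, all distances become integers.
    - They have no common prime factor (prime_ndvd_scaled_distance).  A prime
      dividing 1 + 4j^2 does not divide the distance between the points 0 and
      j, since that distance has 1 + 4j^2 as its exact denominator before
      scaling and the rest of M is coprime to it.  Any other
      prime fails to divide one of the distances from 0 to 1 and to 2, which
      are 29 and 82 up to factors dividing M.
    - The set is congruent to a set of lattice points
      (scaled_nodes_in_lattice).  The coordinates y + iz may have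
      (1+t^2)^2 in the denominator, but only the pole (t-i)^2 is present;
      multiplication by the complex number of modulus 1 with value
      prod (t-i) / prod (t+i), which is a rotation about the x axis, and then
      by M = prod (t-i)(t+i), removes it, and the factor 8 in the numerator
      leaves room for halving.

    Finally, the last k can be taken arbitrarily large with n fixed, so that
    the ratio of the largest to the smallest distance is unbounded.  As this
    ratio is a similarity invariant, infinitely many similarity classes occur
    (infinite_dissimilar_family). *)

Set Implicit Arguments.
Unset Strict Implicit.
Unset Printing Implicit Defensive.

Import Order.TTheory GRing.Theory Num.Theory.
Local Open Scope ring_scope.

(** * Affine functions and affine independence *)

Definition affine_form (R : realType) (m : nat) (b : R) (a : 'cV[R]_m)
    (x : 'rV[R]_m) : R := b + (x *m a) 0 0.

Lemma affine_form_sum (R : realType) (m : nat) (b : R) (a : 'cV[R]_m)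
    (Q : {fset 'rV[R]_m}) (c : 'rV[R]_m -> R) :
  \sum_(p <- Q) c p * affine_form b a p =
  (\sum_(p <- Q) c p) * b + ((\sum_(p <- Q) c p *: p) *m a) 0 0.
Proof.
rewrite mulmx_suml summxE mulr_suml -big_split /=; apply: eq_bigr => p _.
by rewrite mulrDr -scalemxAl [in RHS]mxE.
Qed.

Lemma affinely_independent_sub (R : realType) (m : nat)
    (Q Q' : {fset 'rV[R]_m}) :
  (Q `<=` Q')%fset -> affinely_independent Q' -> affinely_independent Q.
Proof.
move=> sQ aiQ' c c0 cp0 p pQ.
pose c' x := if x \in Q then c x else 0.
have c'E : c' p = c p by rewrite /c' pQ.
rewrite -c'E; apply: aiQ'; last exact: (fsubsetP sQ).
- rewrite -(big_fset_incl _ sQ) => [|x _ xQ]; last by rewrite /c' (negPf xQ).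
  by rewrite -[RHS]c0; apply: eq_big_seq => x xQ; rewrite /c' xQ.
- rewrite -(big_fset_incl _ sQ) => [|x _ xQ]; last first.
    by rewrite /c' (negPf xQ) scale0r.
  by rewrite -[RHS]cp0; apply: eq_big_seq => x xQ; rewrite /c' xQ.
Qed.

(** Evaluating the form on an affine relation leaves only the coefficient of
    [x], which must then vanish. *)
Lemma affinely_independent_extend (R : realType) (m : nat)
    (Q : {fset 'rV[R]_m}) (x : 'rV[R]_m) (b : R) (a : 'cV[R]_m) :
  affinely_independent Q -> (forall p, p \in Q -> affine_form b a p = 0) ->
  affine_form b a x != 0 -> affinely_independent (x |` Q)%fset.
Proof.
move=> aiQ Q0 x0 c c0 cp0.
have xQ : x \notin Q by apply: contraNN x0 => /Q0 ->.
have cx : c x = 0.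
  have := affine_form_sum b a (x |` Q)%fset c.
  rewrite c0 cp0 mul0r mul0mx mxE addr0 big_fsetU1 //= big_seq big1 => [|p /Q0 ->].
    by rewrite addr0 => /eqP; rewrite mulf_eq0 (negPf x0) orbF => /eqP.
  by rewrite mulr0.
move=> p /fset1UP[->//|]; apply: aiQ.
- by rewrite -[RHS]c0 big_fsetU1 //= cx add0r.
- by rewrite -[RHS]cp0 big_fsetU1 //= cx scale0r add0r.
Qed.

(** Affine relations between points are linear relations between the rows
    (p, 1), and affine functions vanishing on the points are vectors of the
    kernel on the other side; rank arguments become available. *)
Definition homogeneous_rows (R : realType) (m : nat) (Q : {fset 'rV[R]_m}) :
    'M[R]_(#|` Q|%fset, m + 1) :=
  \matrix_i row_mx (nth 0 Q i) 1%:M.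

Lemma row_as_coefficients (R : realType) (m : nat) (Q : {fset 'rV[R]_m})
    (v : 'rV[R]_(#|` Q|%fset)) :
  exists2 c : 'rV[R]_m -> R,
    (forall i : 'I_(#|` Q|%fset), c (nth 0 Q i) = v 0 i) &
    forall p, p \notin Q -> c p = 0.
Proof.
exists (fun p => if insub (index p Q) is Some i then v 0 i else 0) => [i|p pQ].
  by rewrite index_uniq ?fset_uniq // valK.
by rewrite insubF // index_mem; apply/negbTE.
Qed.

Lemma homogeneous_rows_mul (R : realType) (m : nat) (Q : {fset 'rV[R]_m})
    (v : 'rV[R]_(#|` Q|%fset)) (c : 'rV[R]_m -> R) :
  (forall i : 'I_(#|` Q|%fset), c (nth 0 Q i) = v 0 i) ->
  v *m homogeneous_rows Q =
  row_mx (\sum_(p <- Q) c p *: p) (\sum_(p <- Q) c p)%:M.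
Proof.
move=> cE; rewrite mulmx_sum_row.
rewrite (big_nth 0 xpredT c) (big_nth 0 xpredT (fun p => c p *: p)) !big_mkord.
have -> : (\sum_(i < #|` Q|%fset) c (nth 0 Q i))%:M =
  \sum_(i < #|` Q|%fset) (c (nth 0 Q i))%:M :> 'M_1 by rewrite raddf_sum.
apply/rowP => j; rewrite summxE.
case: (split_ordP j) => k ->; rewrite ?row_mxEl ?row_mxEr summxE.
  by apply: eq_bigr => i _; rewrite rowK scale_row_mx cE row_mxEl.
by apply: eq_bigr => i _; rewrite rowK scale_row_mx cE row_mxEr !mxE mulr_natr.
Qed.

Lemma homogeneous_rows_affine_form (R : realType) (m : nat)
    (Q : {fset 'rV[R]_m}) (b : R) (a : 'cV[R]_m) :
  (forall p, p \in Q -> affine_form b a p = 0) <->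
  homogeneous_rows Q *m col_mx a b%:M = 0.
Proof.
have E (i : 'I_(#|` Q|%fset)) :
    (homogeneous_rows Q *m col_mx a b%:M) i 0 = affine_form b a (nth 0 Q i).
  transitivity ((row i (homogeneous_rows Q) *m col_mx a b%:M) 0 0).
    by rewrite -row_mul [RHS]mxE.
  by rewrite rowK mul_row_col mul1mx [LHS]mxE [X in _ + X]mxE eqxx mulr1n addrC.
split=> [Q0|eq0 p pQ].
  by apply/matrixP => i j; rewrite ord1 E Q0 ?mxE ?mem_nth.
have pi : (index p Q < #|` Q|%fset)%N by rewrite index_mem.
by rewrite -[p](nth_index 0 pQ) -(E (Ordinal pi)) eq0 mxE.
Qed.

(** There are at most m linear conditions on the m + 1 coefficients. *)
Lemma exists_vanishing_affine_form (R : realType) (m : nat)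
    (Q : {fset 'rV[R]_m}) : (#|` Q|%fset <= m)%N ->
  exists (b : R) (a : 'cV[R]_m),
    ((b != 0) || (a != 0)) /\ forall p, p \in Q -> affine_form b a p = 0.
Proof.
move=> leQ; set A := homogeneous_rows Q.
have : ~~ row_free A^T.
  rewrite /row_free mxrank_tr neq_ltn; apply/orP; left.
  by rewrite (leq_ltn_trans (rank_leq_row A)) // addn1 ltnS.
rewrite -kermx_eq0 => /rowV0Pn[v /sub_kermxP vA v0].
pose w : 'cV_(m + 1) := v^T.
have wE : w = col_mx (usubmx w) ((dsubmx w) 0 0)%:M.
  by rewrite -mx11_scalar vsubmxK.
exists ((dsubmx w) 0 0), (usubmx w); split.
  rewrite -negb_and; apply: contraNN v0 => /andP[/eqP b0 /eqP a0].
  by rewrite -trmx_eq0 -/w wE b0 a0 raddf0 col_mx0.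
apply/homogeneous_rows_affine_form; rewrite -wE.
by apply: trmx_inj; rewrite trmx_mul trmxK vA trmx0.
Qed.

Lemma affinely_independent_row_free (R : realType) (m : nat)
    (Q : {fset 'rV[R]_m}) :
  affinely_independent Q -> row_free (homogeneous_rows Q).
Proof.
move=> aiQ; rewrite -kermx_eq0; apply/rowV0P => v /sub_kermxP vA.
have [c cE _] := row_as_coefficients v.
have := homogeneous_rows_mul cE.
rewrite vA -row_mx0 => /esym/eq_row_mx[cp0 c0].
apply/rowP => i; rewrite mxE -cE aiQ ?mem_nth //.
by have /matrixP/(_ 0 0) := c0; rewrite !mxE eqxx mulr1n.
Qed.

(** Here the matrix of the rows (p, 1) is square and invertible. *)
Lemma affine_form_eq0 (R : realType) (m : nat) (Q : {fset 'rV[R]_m})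
    (b : R) (a : 'cV[R]_m) :
  affinely_independent Q -> #|` Q|%fset = m.+1 ->
  (forall p, p \in Q -> affine_form b a p = 0) -> b = 0 /\ a = 0.
Proof.
move=> /affinely_independent_row_free rfQ cQ /homogeneous_rows_affine_form.
move: (homogeneous_rows Q) rfQ; rewrite cQ -addn1 => A.
rewrite row_free_unit => uA /(congr1 (mulmx (invmx A))).
rewrite mulKmx // mulmx0 -col_mx0 => /eq_col_mx[-> b0]; split=> //.
by have /matrixP/(_ 0 0) := b0; rewrite !mxE eqxx mulr1n.
Qed.

(** The coordinates of (x, 1) in the invertible matrix of the rows (p, 1)
    are barycentric coordinates of x. *)
Lemma affinely_spans_of_independent (R : realType) (m : nat)
    (P Q : {fset 'rV[R]_m}) :
  (Q `<=` P)%fset -> affinely_independent Q -> #|` Q|%fset = m.+1 -> affinely_spans P.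
Proof.
move=> sQ /affinely_independent_row_free rfQ cQ x.
have /row_fullP[B BA] : row_full (homogeneous_rows Q).
  by move: rfQ; rewrite /row_free /row_full => /eqP ->; rewrite cQ addn1.
pose v : 'rV_(#|` Q|%fset) := row_mx x 1%:M *m B.
have [c cE c0] := row_as_coefficients v.
have := homogeneous_rows_mul cE.
rewrite -mulmxA BA mulmx1 => /eq_row_mx[xE oneE]; exists c.
split.
  rewrite -(big_fset_incl _ sQ) => [|p _ /c0 //].
  by have /matrixP/(_ 0 0) := oneE; rewrite !mxE eqxx !mulr1n.
by rewrite -(big_fset_incl _ sQ) => [|p _ /c0 ->]; rewrite ?scale0r // xE.
Qed.

(** * Adding points one at a time *)

(** Sets smaller than m + 1 are included, so that the property can be built up
    from the empty set. *)
Definition linearly_general (R : realType) (m : nat) (P : {fset 'rV[R]_m}) :=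
  forall Q : {fset 'rV[R]_m},
    (Q `<=` P)%fset -> (#|` Q|%fset <= m.+1)%N -> affinely_independent Q.

(** A discrete way to say that the curve carrying the points meets each
    hyperplane finitely often. *)
Definition eventually_escapes (R : realType) (m : nat) (g : nat -> 'rV[R]_m) :=
  forall (b : R) (a : 'cV[R]_m), (b != 0) || (a != 0) ->
    exists B : nat, forall k, (B <= k)%N -> affine_form b a (g k) != 0.

(** Each subset [Q] of at most m old points lies on some hyperplane; a new
    point off that hyperplane is independent of [Q].  There are finitely many
    [Q], each excluding finitely many indices. *)
Lemma linearly_general_extend (R : realType) (m : nat) (g : nat -> 'rV[R]_m)
    (P : {fset 'rV[R]_m}) :
  eventually_escapes g -> linearly_general P ->
  exists B : nat, forall k, (B <= k)%N -> linearly_general (g k |` P)%fset.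
Proof.
move=> esc genP.
have /choice[B HB] : forall Q : {fset 'rV[R]_m}, exists B : nat,
    (Q `<=` P)%fset -> (#|` Q|%fset <= m)%N ->
    forall k, (B <= k)%N -> affinely_independent (g k |` Q)%fset.
  move=> Q; have [leQ|gtQ] := leqP #|` Q|%fset m; last first.
    by exists 0%N.
  have [b [a [ab0 Q0]]] := exists_vanishing_affine_form leQ.
  have [B HB] := esc b a ab0; exists B => sQ _ k /HB gk.
  by apply: affinely_independent_extend Q0 gk; apply: genP (leqW leQ).
exists (\sum_(Q <- fpowerset P) B Q)%N => k lek Q sQ leQ.
have [gQ|gQ] := boolP (g k \in Q); last first.
  apply: genP => //; apply/fsubsetP => x xQ.
  by have /fset1UP[xg|//] := fsubsetP sQ _ xQ; rewrite -xg xQ in gQ.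
rewrite -(fsetD1K gQ); set Q' := (Q `\ g k)%fset.
have sQ' : (Q' `<=` P)%fset.
  apply/fsubsetP => x /fsetD1P[xg xQ].
  by have /fset1UP[/eqP|//] := fsubsetP sQ _ xQ; rewrite (negPf xg).
apply: HB => //; first by move: leQ; rewrite (cardfsD1 (g k)) gQ.
apply: leq_trans lek; rewrite (big_fsetD1 Q') ?fpowersetE //=.
exact: leq_addr.
Qed.

(** * The curve with rational chords *)

Definition vec3 (R : realType) (x y z : R) : 'rV[R]_3 :=
  \row_(i < 3) nth 0 [:: x; y; z] i.

Lemma vec3_mul (R : realType) (x y z : R) (a : 'cV[R]_3) :
  (vec3 x y z *m a) 0 0 = x * a 0 0 + y * a 1 0 + z * a 2%:R 0.
Proof.
rewrite mxE !big_ord_recl big_ord0 !mxE /= addr0 addrA.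
by congr (_ + _ * a _ _ + _ * a _ _); apply: val_inj.
Qed.

Lemma edist_vec3 (R : realType) (x y z x' y' z' : R) :
  edist (vec3 x y z) (vec3 x' y' z') =
  Num.sqrt ((x - x') ^+ 2 + (y - y') ^+ 2 + (z - z') ^+ 2).
Proof. by rewrite /edist !big_ord_recl big_ord0 !mxE /= addr0 addrA. Qed.

Definition curve (R : realType) (t : R) : 'rV[R]_3 :=
  vec3 (t - 8 * t / (1 + t ^+ 2))
       (8 * (t ^+ 3 - 3 * t) / (1 + t ^+ 2) ^+ 2)
       (8 * (3 * t ^+ 2 - 1) / (1 + t ^+ 2) ^+ 2).

Lemma add1sqr_neq0 (R : realType) (t : R) : 1 + t ^+ 2 != 0.
Proof. by rewrite gt_eqF // ltr_pwDl ?sqr_ge0. Qed.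

(** The squared chord is the square of a rational function because, with
    D = (1+s^2)(1+t^2), one has
    (D + 8st + 24)^2 - (D + 8st - 8)^2 = 64 ((st+3)^2 + (s+t)^2),
    where the left side compares the claimed length with the x coordinate and
    the right side is what the y and z coordinates contribute. *)
Lemma edist_curve (R : realType) (s t : R) : 0 <= s -> 0 <= t ->
  edist (curve s) (curve t) =
  `|s - t| * (1 + 8 * (s * t + 3) / ((1 + s ^+ 2) * (1 + t ^+ 2))).
Proof.
move=> s0 t0; rewrite edist_vec3.
have := add1sqr_neq0 s; have := add1sqr_neq0 t => tn0 sn0.
set c := 1 + _ / _.
have c0 : 0 <= c.
  rewrite addr_ge0 // divr_ge0 ?mulr_ge0 ?addr_ge0 ?sqr_ge0 ?mulr_ge0 //.
transitivity (Num.sqrt (((s - t) * c) ^+ 2)); last first.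
  by rewrite sqrtr_sqr normrM (ger0_norm c0).
by congr (Num.sqrt _); rewrite /c; field; rewrite tn0.
Qed.

Lemma curve_inj (R : realType) (s t : R) : 0 <= s -> 0 <= t ->
  curve s = curve t -> s = t.
Proof.
move=> s0 t0 eq_st; have := edist_curve s0 t0.
rewrite eq_st /edist big1 => [|i _]; last by rewrite subrr expr0n.
rewrite sqrtr0 => /esym/eqP; rewrite mulf_eq0 normr_eq0 subr_eq0.
case/orP => [/eqP //|]; rewrite gt_eqF // ltr_pwDl //.
by rewrite divr_ge0 ?mulr_ge0 ?addr_ge0 ?sqr_ge0 ?mulr_ge0.
Qed.

(** A sphere in R^m is the trace of a hyperplane of R^(m+1) on the paraboloid,
    so that cospherical points have affinely dependent lifts. *)
Definition paraboloid_lift (R : realType) (m : nat) (x : 'rV[R]_m) :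
    'rV[R]_(m + 1) := row_mx x (x *m x^T).

Lemma paraboloid_lift_inj (R : realType) (m : nat) :
  injective (@paraboloid_lift R m).
Proof. by move=> x y /eq_row_mx[]. Qed.

Lemma affine_form_lift (R : realType) (m : nat) (b : R) (a : 'cV[R]_m) (e : R)
    (x : 'rV[R]_m) :
  affine_form b (col_mx a e%:M) (paraboloid_lift x) =
  affine_form b a x + e * (x *m x^T) 0 0.
Proof.
rewrite /affine_form mul_row_col [X in b + X]mxE addrA; congr (_ + _).
by rewrite mul_mx_scalar mxE.
Qed.

Lemma vec3_norm (R : realType) (x y z : R) :
  (vec3 x y z *m (vec3 x y z)^T) 0 0 = x ^+ 2 + y ^+ 2 + z ^+ 2.
Proof. by rewrite vec3_mul !mxE. Qed.

(** Cleared of denominators, the functions 1, x, y, z, x^2+y^2+z^2 become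
    polynomials of the distinct degrees 4, 5, 3, 2, 6. *)
Lemma affine_form_curve (R : realType) (b : R) (a : 'cV[R]_3) (e : R) :
  [|| b != 0, a != 0 | e != 0] -> exists2 p : {poly R}, p != 0 &
  forall t, (1 + t ^+ 2) ^+ 2 *
    affine_form b (col_mx a e%:M) (paraboloid_lift (curve t)) = p.[t].
Proof.
set a1 := a 0 0; set a2 := a 1 0; set a3 := a 2%:R 0 => nz.
(* The coefficients of (1+t^2)^2 times the form, by increasing degree. *)
pose c := [:: b - 8 * a3 + 64 * e; - 7 * a1 - 24 * a2;
  2 * b + 24 * a3 + 113 * e; - 6 * a1 + 8 * a2; b - 14 * e; a1; e].
exists (Poly c); last first.
  move=> t; rewrite affine_form_lift /affine_form vec3_mul vec3_norm.
  rewrite -/a1 -/a2 -/a3 horner_Poly /=.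
  by field; exact: add1sqr_neq0.
apply: contraTneq nz => c0.
have ci i : nth 0 c i = 0 by rewrite -coef_Poly c0 coef0.
have e0 : e = 0 := ci 6.
have a10 : a1 = 0 := ci 5.
have b0 : b = 0 by have /= := ci 4; rewrite e0; lra.
have a20 : a2 = 0 by have /= := ci 3; rewrite a10; lra.
have a30 : a3 = 0 by have /= := ci 0%N; rewrite e0 b0; lra.
have a0 : a = 0.
  apply/matrixP => i j; rewrite ord1 mxE.
  have : i \in [:: 0; 1; 2%:R] by case: i => [[|[|[|]]]].
  by rewrite !inE => /or3P[] /eqP ->.
by rewrite e0 b0 a0 !eqxx.
Qed.

(** Even parameters make 1 + t^2 odd, which later keeps the prime 2 away from
    the modulus. *)
Definition node (R : realType) (k : nat) : 'rV[R]_3 := curve (2 * k%:R).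

Lemma node_inj (R : realType) : injective (@node R).
Proof.
move=> k l /curve_inj; rewrite !mulr_ge0 // => /(_ isT isT).
have two0 : (2 : R) != 0 by rewrite pnatr_eq0.
by move/(mulfI two0)/eqP; rewrite eqr_nat => /eqP.
Qed.

(** A nonzero polynomial has no root beyond its Cauchy bound. *)
Lemma lifted_node_escapes (R : realType) :
  eventually_escapes (fun k => paraboloid_lift (node R k)).
Proof.
move=> b a nz; rewrite -(vsubmxK a) [dsubmx a]mx11_scalar.
set a' := usubmx a; set e := dsubmx a 0 0.
have : [|| b != 0, a' != 0 | e != 0].
  apply: contraTT nz; rewrite !negb_or !negbK => /and3P[-> /eqP a0 /eqP e0].
  by rewrite -(vsubmxK a) [dsubmx a]mx11_scalar -/a' -/e a0 e0 raddf0 col_mx0 eqxx.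
case/affine_form_curve => p p0 pE.
exists (Num.truncn (cauchy_bound p)).+1 => k lek; apply/negP => /eqP form0.
have := pE (2 * k%:R); rewrite -/(node R k) form0 mulr0 => /esym.
move=> /(cauchy_boundP p0); apply/negP; rewrite -leNgt.
have lek' : cauchy_bound p <= k%:R.
  apply: le_trans (ltW (truncnS_gt _)) _; by rewrite ler_nat.
rewrite ger0_norm ?mulr_ge0 //; apply: le_trans lek' _.
by rewrite mulr_natl mulr2n lerDl.
Qed.

Lemma node_escapes (R : realType) : eventually_escapes (@node R).
Proof.
move=> b a nz.
have nz' : (b != 0) || (col_mx a (0 : R)%:M != 0).
  case/orP: nz => [->//|a0]; apply/orP; right.
  by apply: contraNneq a0; rewrite -col_mx0 => /eq_col_mx[->].
have [B HB] := lifted_node_escapes nz'; exists B => k /HB.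
by rewrite affine_form_lift mul0r addr0.
Qed.

(** * General position *)

(** The equation of the sphere is an affine function of the lift, with
    coefficient 1 on the last coordinate; it cannot vanish on m + 2 lifted
    points that are independent in R^(m+1). *)
Lemma no_common_sphere (R : realType) (m : nat) (P Q : {fset 'rV[R]_m}) :
  linearly_general (@paraboloid_lift R m @` P)%fset ->
  (Q `<=` P)%fset -> #|` Q|%fset = m.+2 -> ~ on_common_sphere Q.
Proof.
move=> genP sQ cQ [z [r [r0 Qz]]].
pose Q' := (@paraboloid_lift R m @` Q)%fset.
have cQ' : #|` Q'|%fset = (m + 1).+1.
  by rewrite card_imfset ?cQ ?addn1 //; exact: paraboloid_lift_inj.
have aiQ' : affinely_independent Q'.
  apply: genP; last by rewrite cQ'.
  by apply: subset_imfset => x; exact: (fsubsetP sQ).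
(* The function |p|^2 - 2 p.z + |z|^2 - r^2. *)
pose b := (z *m z^T) 0 0 - r ^+ 2; pose a := (- 2) *: z^T.
have [_ /eqP] : b = 0 /\ col_mx a 1%:M = 0.
  apply: affine_form_eq0 aiQ' cQ' _ => _ /imfsetP[p /= pQ ->].
  rewrite affine_form_lift /affine_form mul1r.
  have pr : \sum_(i < m) (p 0 i - z 0 i) ^+ 2 = r ^+ 2.
    by rewrite -(Qz p pQ) sqr_sqrtr // sumr_ge0 // => i _; rewrite sqr_ge0.
  rewrite /b -pr !mxE addrAC -sumrB -!big_split /=.
  by apply: big1 => i _; rewrite !mxE; ring.
rewrite -col_mx0 => /eqP/eq_col_mx[_ /matrixP/(_ 0 0)].
by rewrite !mxE => /eqP; rewrite eqxx mulr1n oner_eq0.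
Qed.

Lemma general_position_of_lift (R : realType) (m : nat) (P : {fset 'rV[R]_m}) :
  linearly_general P -> linearly_general (@paraboloid_lift R m @` P)%fset ->
  general_position P.
Proof.
move=> genP genlP; split=> Q sQ cQ; first by apply: genP; rewrite ?cQ.
exact: no_common_sphere genlP sQ cQ.
Qed.

Lemma edist_scale (R : realType) (m : nat) (c : R) (x y : 'rV[R]_m) : 0 <= c ->
  edist (c *: x) (c *: y) = c * edist x y.
Proof.
move=> c0; rewrite /edist.
transitivity (Num.sqrt (c ^+ 2 * \sum_(i < m) (x 0 i - y 0 i) ^+ 2)).
  congr Num.sqrt; rewrite mulr_sumr; apply: eq_bigr => i _.
  by rewrite !mxE -mulrBr exprMn.
by rewrite sqrtrM ?sqr_ge0 // sqrtr_sqr ger0_norm.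
Qed.

Lemma affinely_independent_scale (R : realType) (m : nat) (c : R)
    (Q : {fset 'rV[R]_m}) : c != 0 ->
  affinely_independent Q -> affinely_independent [fset c *: x | x in Q]%fset.
Proof.
move=> c0 aiQ w w0 wp0 _ /imfsetP[p /= pQ ->].
have inj : {in Q &, injective (fun x : 'rV[R]_m => c *: x)}.
  by move=> x y _ _; exact: scalerI.
apply: (aiQ (fun x => w (c *: x))) => //.
  by rewrite big_imfset in w0.
rewrite big_imfset //= in wp0; apply: (scalerI c0).
rewrite scaler0 scaler_sumr -[RHS]wp0; apply: eq_bigr => x _.
by rewrite !scalerA mulrC.
Qed.

(** Subsets of the scaled set are pulled back by the inverse scaling. *)
Lemma general_position_scale (R : realType) (m : nat) (c : R)
    (P : {fset 'rV[R]_m}) : 0 < c ->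
  general_position P -> general_position [fset c *: x | x in P]%fset.
Proof.
move=> c0 [aiP spP]; have cn0 : c != 0 by rewrite gt_eqF.
have pull (Q : {fset 'rV[R]_m}) : (Q `<=` [fset c *: x | x in P])%fset ->
    exists2 Q' : {fset 'rV[R]_m}, (Q' `<=` P)%fset &
      Q = [fset c *: x | x in Q']%fset.
  move=> /fsubsetP sQ; exists [fset c^-1 *: x | x in Q]%fset.
    apply/fsubsetP => _ /imfsetP[x /= /sQ/imfsetP[y /= yP ->] ->].
    by rewrite scalerA mulVf // scale1r.
  apply/fsetP => x; apply/idP/imfsetP => [xQ|[_ /imfsetP[y /= yQ ->] ->]].
    exists (c^-1 *: x); first exact: in_imfset.
    by rewrite scalerA mulfV // scale1r.
  by rewrite scalerA mulfV // scale1r.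
have cardE (Q : {fset 'rV[R]_m}) : #|` [fset c *: x | x in Q]|%fset = #|` Q|%fset.
  by apply: card_imfset; exact: scalerI.
split=> _ /pull[Q sQ ->]; rewrite cardE => cQ.
  by apply: affinely_independent_scale => //; exact: aiP.
move=> [z [r [r0 Qz]]]; apply: (spP Q sQ cQ); exists (c^-1 *: z), (r / c).
split=> [|p pQ]; first by rewrite divr_gt0.
apply: (mulfI cn0); rewrite -edist_scale ?ltW // scalerA mulfV // scale1r.
by rewrite [RHS]mulrC divfK // Qz //; exact: in_imfset.
Qed.

(** * The distances as integers *)

Definition node_norm (k : nat) : nat := (1 + 4 * k ^ 2)%N.

Definition modulus (T : {fset nat}) : nat := (\prod_(k <- T) node_norm k)%N.

Definition nat_distance (k l : nat) : nat := ((k - l) + (l - k))%N.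

(** The distance between the points k and l after scaling by half the modulus;
    for k <> l the division is exact. *)
Definition scaled_distance (T : {fset nat}) (k l : nat) : nat :=
  (nat_distance k l * (node_norm k * node_norm l + 8 * (4 * (k * l) + 3)) *
   (modulus T %/ (node_norm k * node_norm l)))%N.

(** The indices 0, 1, 2 are the ones whose mutual distances settle
    primitivity. *)
Record admissible (R : realType) (T : {fset nat}) : Prop := Admissible {
  adm0 : 0%N \in T;
  adm1 : 1%N \in T;
  adm2 : 2%N \in T;
  adm_coprime :
    {in T &, forall k l, k != l -> coprime (node_norm k) (node_norm l)};
  adm_general : linearly_general (@node R @` T)%fset;
  adm_lifted_general :
    linearly_general (@paraboloid_lift R 3 @` (@node R @` T))%fset }.

Lemma node_norm_gt0 k : (0 < node_norm k)%N. Proof. by []. Qed.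

Lemma modulus_gt0 T : (0 < modulus T)%N.
Proof. by rewrite prodn_gt0. Qed.

Lemma modulus_D1 (T : {fset nat}) (k : nat) : k \in T ->
  modulus T = (node_norm k * modulus (T `\ k)%fset)%N.
Proof. by move=> kT; rewrite /modulus (big_fsetD1 k). Qed.

Lemma modulus_D2 (T : {fset nat}) (k l : nat) : k \in T -> l \in T -> k != l ->
  modulus T = (node_norm k * node_norm l * modulus (T `\ k `\ l)%fset)%N.
Proof.
move=> kT lT kl; rewrite (modulus_D1 kT) (@modulus_D1 _ l) ?mulnA //.
by rewrite !inE lT eq_sym kl.
Qed.

Lemma natr_nat_distance (R : realType) (k l : nat) :
  (nat_distance k l)%:R = `|k%:R - l%:R| :> R.
Proof.
have [kl|/ltnW kl] := leqP k l.
  by rewrite /nat_distance (eqP kl) distrC ger0_norm ?subr_ge0 ?ler_nat // natrB.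
by rewrite /nat_distance (eqP kl) addn0 ger0_norm ?subr_ge0 ?ler_nat // natrB.
Qed.

Lemma edist_scaled_node (R : realType) (T : {fset nat}) (k l : nat) :
  k \in T -> l \in T ->
  edist (((modulus T)%:R / 2) *: node R k) (((modulus T)%:R / 2) *: node R l) =
  (scaled_distance T k l)%:R.
Proof.
move=> kT lT.
rewrite edist_scale ?divr_ge0 // edist_curve ?mulr_ge0 // -mulrBr normrM.
rewrite -natr_nat_distance (@ger0_norm _ 2) //.
have [<-|kl] := eqVneq k l.
  by rewrite /scaled_distance /nat_distance subnn !mul0n !(mulr0, mul0r).
rewrite /scaled_distance (modulus_D2 kT lT kl) mulKn ?muln_gt0 ?node_norm_gt0 //.
set m := modulus _; set d := nat_distance k l.
have kn0 := add1sqr_neq0 (2 * k%:R : R).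
have ln0 := add1sqr_neq0 (2 * l%:R : R).
have gE i : (node_norm i)%:R = 1 + (2 * i%:R) ^+ 2 :> R.
  by rewrite /node_norm natrD natrM natrX; ring.
rewrite !natrM (natrD _ (node_norm k * node_norm l)) !natrM (natrD _ (4 * (k * l))).
rewrite !natrM !gE; field.
by rewrite ln0.
Qed.

Lemma scaled_node_inj (R : realType) (T : {fset nat}) :
  injective (fun k => ((modulus T)%:R / 2) *: node R k).
Proof.
move=> k l /scalerI E; apply/(@node_inj R)/E.
by rewrite mulf_neq0 ?invr_eq0 ?pnatr_eq0 // -lt0n modulus_gt0.
Qed.

Lemma scaled_distance_gt0 (T : {fset nat}) (k l : nat) :
  k \in T -> l \in T -> k != l -> (0 < scaled_distance T k l)%N.
Proof.
move=> kT lT kl; rewrite /scaled_distance (modulus_D2 kT lT kl) mulKn //.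
rewrite !muln_gt0 modulus_gt0 andbT addn_gt0 muln_gt0 !node_norm_gt0.
by rewrite orTb andbT /nat_distance addn_gt0 !subn_gt0 -neq_ltn eq_sym.
Qed.

Lemma scaled_distance0 (T : {fset nat}) (k : nat) : 0%N \in T -> k \in T -> k != 0%N ->
  scaled_distance T 0 k = (k * (node_norm k + 24) * modulus (T `\ k)%fset)%N.
Proof.
move=> T0 kT k0; rewrite /scaled_distance (modulus_D1 kT) mul1n mulKn ?node_norm_gt0 //.
by rewrite /nat_distance sub0n subn0 mul0n muln0.
Qed.

Lemma prime_dvd_modulus (q : nat) (T : {fset nat}) : prime q -> (q %| modulus T)%N ->
  exists2 k, k \in T & (q %| node_norm k)%N.
Proof.
move=> pq; rewrite /modulus big_seq.
apply: (big_ind (fun m => (q %| m)%N -> exists2 k, k \in T & (q %| node_norm k)%N)).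
- by rewrite dvdn1 => /eqP q1; rewrite q1 in pq.
- by move=> a b IHa IHb; rewrite Euclid_dvdM // => /orP[/IHa|/IHb].
- by move=> k kT qk; exists k.
Qed.

(** A common prime divisor of 1 + 4k^2 and of 24 + (1 + 4k^2) would be 2 or 3,
    but 1 + 4k^2 is odd, and -1 is not a square modulo 3. *)
Lemma node_norm_prime_dvd q k : prime q -> (q %| node_norm k)%N ->
  ~~ (q %| k)%N && ~~ (q %| node_norm k + 24)%N.
Proof.
move=> pq qk; apply/andP; split; apply/negP.
  move=> qdk; move: qk; rewrite /node_norm dvdn_addl; last first.
    by rewrite expnS mulnCA dvdn_mulr.
  by rewrite dvdn1 => /eqP q1; rewrite q1 in pq.
rewrite dvdn_addr // (_ : 24 = 2 ^ 3 * 3)%N // Euclid_dvdM // Euclid_dvdX //.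
rewrite andbT !dvdn_prime2 // => /orP[] /eqP q_eq; move: qk; rewrite q_eq /node_norm.
  by rewrite dvdn2 oddD oddM.
rewrite /dvdn -modnDmr -modnMmr -modnXm.
by have := ltn_pmod k (isT : (0 < 3)%N); case: (k %% 3)%N => [|[|[|]]].
Qed.

(** A prime factor q of the modulus divides some 1 + 4k^2, and then the pair
    (0, k) works: its distance is k (1 + 4k^2 + 24) times the factors of the
    modulus other than 1 + 4k^2.  For the other primes the pair (0, 1) works
    unless q = 29, in which case (0, 2) does. *)
Lemma prime_ndvd_scaled_distance (R : realType) (T : {fset nat}) q :
  admissible R T -> prime q ->
  exists k l : nat, [/\ k \in T, l \in T, k != l & ~~ (q %| scaled_distance T k l)%N].
Proof.
move=> admT pq; have [T0 T1 T2 cop _ _] := admT.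
have [/(prime_dvd_modulus pq)[k kT qk]|qM] := boolP (q %| modulus T)%N.
  have k0 : k != 0%N.
    by apply: contraTneq qk => ->; rewrite dvdn1 neq_ltn prime_gt1 ?orbT.
  exists 0%N, k; split; rewrite // 1?eq_sym // scaled_distance0 // !Euclid_dvdM //.
  have /andP[/negPf-> /negPf->] := node_norm_prime_dvd pq qk.
  apply/negP => /(prime_dvd_modulus pq)[l]; rewrite !inE => /andP[lk lT] ql.
  have := cop _ _ lT kT lk; rewrite /coprime => /eqP g1.
  by have := dvdn_gcd q (node_norm l) (node_norm k); rewrite g1 ql qk Euclid_dvd1.
have qM' k : k \in T -> ~~ (q %| modulus (T `\ k)%fset)%N.
  by move=> kT; apply: contraNN qM => qMk; rewrite (modulus_D1 kT) dvdn_mull.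
have [/eqP q29|q29] := boolP (q == 29)%N.
  exists 0%N, 2%N; split=> //; rewrite scaled_distance0 // Euclid_dvdM // negb_or qM' //.
  by rewrite q29.
exists 0%N, 1%N; split=> //; rewrite scaled_distance0 // Euclid_dvdM // negb_or qM' //.
by rewrite andbT mul1n -[(_ + _)%N]/29%N dvdn_prime2.
Qed.

(** * The clusters *)

Definition scaled_nodes (R : realType) (T : {fset nat}) : {fset 'rV[R]_3} :=
  [fset ((modulus T)%:R / 2) *: node R k | k in T]%fset.

Lemma scaled_nodesP (R : realType) (T : {fset nat}) (x : 'rV[R]_3) :
  reflect (exists2 k, k \in T & x = ((modulus T)%:R / 2) *: node R k)
          (x \in scaled_nodes R T).
Proof. exact: imfsetP. Qed.

Lemma card_scaled_nodes (R : realType) (T : {fset nat}) :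
  #|` scaled_nodes R T|%fset = #|` T|%fset.
Proof. by apply: card_imfset; exact: scaled_node_inj. Qed.

Lemma general_position_scaled_nodes (R : realType) (T : {fset nat}) :
  admissible R T -> general_position (scaled_nodes R T).
Proof.
move=> admT.
have -> : scaled_nodes R T =
    [fset ((modulus T)%:R / 2) *: x | x in [fset node R k | k in T]]%fset.
  apply/fsetP => x; apply/scaled_nodesP/imfsetP => /= [[k kT ->]|].
    by exists (node R k) => //; exact: in_imfset.
  by move=> [_ /imfsetP[k /= kT ->] ->]; exists k.
apply: general_position_scale; first by rewrite divr_gt0 ?ltr0n ?modulus_gt0.
apply: general_position_of_lift; first exact: adm_general admT.
exact: adm_lifted_general admT.
Qed.

Lemma exists_fsubset_card (K : choiceType) (P : {fset K}) (n : nat) :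
  (n <= #|` P|%fset)%N -> exists2 Q : {fset K}, (Q `<=` P)%fset & #|` Q|%fset = n.
Proof.
move=> nP; exists [fset x in take n P]%fset.
  by apply/fsubsetP => x; rewrite !inE; exact: mem_take.
rewrite card_fseq undup_id ?size_takel //.
by rewrite take_uniq ?fset_uniq.
Qed.

(** Any four of the points span the space. *)
Lemma integral_scaled_nodes (R : realType) (T : {fset nat}) :
  admissible R T -> (4 <= #|` T|%fset)%N -> integral_point_set (scaled_nodes R T).
Proof.
move=> admT cT; split; last first.
  move=> _ _ /scaled_nodesP[k kT ->] /scaled_nodesP[l lT ->].
  by rewrite edist_scaled_node // natr_int.
have [Q sQ cQ] : exists2 Q, (Q `<=` scaled_nodes R T)%fset & #|` Q|%fset = 4.
  by apply: exists_fsubset_card; rewrite card_scaled_nodes.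
have [aiT _] := general_position_scaled_nodes admT.
exact: affinely_spans_of_independent sQ (aiT Q sQ cQ) cQ.
Qed.

Lemma dvdn_biggcd (I : eqType) (r : seq I) (P : pred I) (F : I -> nat) i :
  i \in r -> P i -> (\big[gcdn/0%N]_(j <- r | P j) F j %| F i)%N.
Proof.
move=> ir Pi; rewrite (big_rem i) //= Pi; exact: dvdn_gcdl.
Qed.

Lemma dvdn_distance_gcd (R : realType) (d : nat) (P : {fset 'rV[R]_d}) x y :
  x \in P -> y \in P -> edist x y != 0 ->
  (distance_gcd P %| Num.truncn (edist x y))%N.
Proof.
move=> xP yP xy0; apply: dvdn_trans (dvdn_biggcd _ xP isT) _.
exact: (@dvdn_biggcd _ P (fun y => edist x y != 0)).
Qed.

Lemma primitive_scaled_nodes (R : realType) (T : {fset nat}) :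
  admissible R T -> primitive (scaled_nodes R T).
Proof.
move=> admT; apply/eqP; apply: contraT => g1.
have [q pq qg] : exists2 q, prime q & (q %| distance_gcd (scaled_nodes R T))%N.
  move: g1; case: (distance_gcd _) => [|[|g]] // _; first by exists 2%N.
  by exists (pdiv g.+2); rewrite ?pdiv_prime ?pdiv_dvd.
have [k [l [kT lT kl /negP[]]]] := prime_ndvd_scaled_distance admT pq.
have edE := edist_scaled_node R kT lT.
rewrite -[scaled_distance T k l](@natrK R) -edE; apply: dvdn_trans qg _.
apply: dvdn_distance_gcd; do ?[apply/scaled_nodesP; by [exists k|exists l]].
by rewrite edE pnatr_eq0 -lt0n scaled_distance_gt0.
Qed.

(** * Realization in the integer lattice *)

(** The integers satisfy a + bi = prod (2k - i) over [s]; the second part says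
    that each factor 2k - i can be split off. *)
Lemma gaussian_product (s : seq nat) : exists a b : int,
  a ^+ 2 + b ^+ 2 = (\prod_(k <- s) node_norm k)%N%:Z /\
  forall k, k \in s -> exists a' b' : int,
    a = (2 * k)%N%:Z * a' + b' /\ b = (2 * k)%N%:Z * b' - a'.
Proof.
elim: s => [|k s [a [b [abE abD]]]]; first by exists 1, 0; rewrite big_nil.
(* Multiply a + bi by 2k - i. *)
exists ((2 * k)%N%:Z * a + b), ((2 * k)%N%:Z * b - a); split.
  rewrite big_cons [RHS]PoszM -abE.
  have -> : (node_norm k)%:Z = 1 + 4 * k%:Z ^+ 2 by rewrite /node_norm PoszD PoszM.
  by rewrite PoszM; ring.
move=> l; rewrite in_cons => /orP[/eqP ->|/abD[a' [b' [-> ->]]]]; first by exists a, b.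
exists ((2 * k)%N%:Z * a' + b'), ((2 * k)%N%:Z * b' - a').
by split; ring.
Qed.

Definition rotation (R : realType) (c s : R) (v : 'rV[R]_3) : 'rV[R]_3 :=
  vec3 (v 0 0) (c * v 0 1 - s * v 0 2%:R) (s * v 0 1 + c * v 0 2%:R).

Lemma vec3_eta (R : realType) (v : 'rV[R]_3) :
  v = vec3 (v 0 0) (v 0 1) (v 0 2%:R).
Proof.
apply/rowP => i; rewrite mxE.
by case: i => [[|[|[|]]]] //= ?; congr (v _ _); apply: val_inj.
Qed.

Lemma rotation_isometry (R : realType) (c s : R) :
  c ^+ 2 + s ^+ 2 = 1 -> is_isometry (rotation c s).
Proof.
move=> cs1 v w; rewrite [in RHS](vec3_eta v) [in RHS](vec3_eta w) !edist_vec3.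
congr Num.sqrt; rewrite -addrA -[RHS]addrA; congr (_ + _).
rewrite -[RHS]mul1r -cs1; ring.
Qed.

(** With a + bi = prod (2k - i), the rotation multiplies y + iz by
    (a + bi)^2 / M.  If a + bi = (t - i)(a' + b'i), the scaled and rotated
    point of parameter t = 2k has y + iz = 4 (t + i)(a' + b'i)^2. *)
Lemma scaled_nodes_in_lattice (R : realType) (T : {fset nat}) :
  exists Q : {fset 'rV[R]_3},
    are_congruent (scaled_nodes R T) Q /\ in_integer_lattice Q.
Proof.
have [a [b [abE abD]]] := gaussian_product T.
set M : R := (modulus T)%:R.
have M0 : M != 0 by rewrite pnatr_eq0 -lt0n modulus_gt0.
have ME : M = a%:~R ^+ 2 + b%:~R ^+ 2.
  by rewrite -!rmorphXn -rmorphD /= abE.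
pose c : R := (a%:~R ^+ 2 - b%:~R ^+ 2) / M.
pose s : R := 2 * a%:~R * b%:~R / M.
exists (rotation c s @` scaled_nodes R T)%fset; split.
  exists (rotation c s); split=> //; apply: rotation_isometry.
  by rewrite /c /s ME; field; rewrite -ME.
move=> _ /imfsetP[_ /= /scaled_nodesP[k kT ->] ->] i.
have [a' [b' [aE bE]]] := abD k kT.
have t0 := add1sqr_neq0 (2 * k%:R : R).
pose t : int := (2 * k)%N%:Z.
have tE : t%:~R = 2 * k%:R :> R by rewrite /t -natrM.
pose m := (modulus (T `\ k)%fset).
pose X : int := m%:Z * (k%:Z * (1 + t ^+ 2) - 4 * t).
pose Y : int := 4 * (t * (a' ^+ 2 - b' ^+ 2) - 2 * a' * b').
pose Z : int := 4 * (2 * t * a' * b' + a' ^+ 2 - b' ^+ 2).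
suff -> : rotation c s ((M / 2) *: node R k) = vec3 X%:~R Y%:~R Z%:~R.
  by rewrite mxE; case: i => [[|[|[|]]]] //= ?; exact: intr_int.
have MgE : M = (1 + (2 * k%:R) ^+ 2) * m%:R.
  rewrite /M (modulus_D1 kT) natrM; congr (_ * _).
  by rewrite /node_norm natrD natrM natrX; ring.
have aR : a%:~R = 2 * k%:R * a'%:~R + b'%:~R :> R.
  by rewrite aE rmorphD rmorphM /= -/t tE.
have bR : b%:~R = 2 * k%:R * b'%:~R - a'%:~R :> R.
  by rewrite bE rmorphB rmorphM /= -/t tE.
rewrite /rotation !mxE /=; congr vec3.
- rewrite MgE /X !(rmorphM, rmorphB, rmorphD, rmorphXn) /= tE; field.
  by [].
- rewrite /c /s aR bR /Y !(rmorphM, rmorphB, rmorphD, rmorphXn) /= tE; field.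
  by rewrite t0.
- rewrite /c /s aR bR /Z !(rmorphM, rmorphB, rmorphD, rmorphXn) /= tE; field.
  by rewrite t0.
Qed.

Lemma cluster_scaled_nodes (R : realType) (T : {fset nat}) :
  admissible R T -> (4 <= #|` T|%fset)%N ->
  cluster #|` T|%fset (scaled_nodes R T).
Proof.
move=> admT cT; split; first exact: card_scaled_nodes.
- exact: integral_scaled_nodes.
- exact: general_position_scaled_nodes.
- exact: scaled_nodes_in_lattice.
Qed.

(** * Existence of admissible index sets *)

Lemma linearly_general_triple (R : realType) (m : nat) (p0 p1 p2 : 'rV[R]_m)
    (b1 b2 : R) (a1 a2 : 'cV[R]_m) :
  affine_form b1 a1 p0 = 0 -> affine_form b1 a1 p1 != 0 ->
  affine_form b2 a2 p0 = 0 -> affine_form b2 a2 p1 = 0 ->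
  affine_form b2 a2 p2 != 0 ->
  linearly_general (p2 |` (p1 |` (p0 |` fset0)))%fset.
Proof.
move=> f10 f11 f20 f21 f22 Q sQ _; apply: affinely_independent_sub sQ _.
apply: (@affinely_independent_extend _ _ _ _ b2 a2) => //; last first.
  by move=> p; rewrite !inE orbF => /orP[] /eqP ->.
apply: (@affinely_independent_extend _ _ _ _ b1 a1) => //; last first.
  by move=> p; rewrite !inE orbF => /eqP ->.
apply: (@affinely_independent_extend _ _ _ _ 1 0).
- by move=> c _ _ p; rewrite inE.
- by move=> p; rewrite inE.
- by rewrite /affine_form mulmx0 mxE addr0 oner_eq0.
Qed.

Lemma affine_form_node (R : realType) (u v w : R) (k : nat) :
  let t := 2 * k%:R in
  affine_form 0 (vec3 u v w)^T (node R k) =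
  (t - 8 * t / (1 + t ^+ 2)) * u +
  (8 * (t ^+ 3 - 3 * t) / (1 + t ^+ 2) ^+ 2) * v +
  (8 * (3 * t ^+ 2 - 1) / (1 + t ^+ 2) ^+ 2) * w.
Proof. by rewrite /affine_form vec3_mul !mxE add0r. Qed.

(** The form x separates the point 1 from the point 0, and the form 8x + 15y
    vanishes at the points 0 and 1 but not at 2, so the three are not
    collinear; the same forms work for the lifts. *)
Lemma admissible_base (R : realType) : admissible R [fset 0; 1; 2]%fset.
Proof.
have -> : [fset 0; 1; 2]%fset = (2 |` (1 |` (0 |` fset0)))%fset :> {fset nat}.
  by apply/fsetP => k; rewrite !inE orbF orbC [(k == 0) || _]orbC.
pose a1 : 'cV[R]_3 := (vec3 1 0 0)^T; pose a2 : 'cV[R]_3 := (vec3 8 15 0)^T.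
have f10 : affine_form 0 a1 (node R 0) = 0 by rewrite affine_form_node; field.
have f20 : affine_form 0 a2 (node R 0) = 0 by rewrite affine_form_node; field.
have f11 : affine_form 0 a1 (node R 1) != 0.
  have -> : affine_form 0 a1 (node R 1) = - (6 / 5).
    by rewrite affine_form_node; field.
  by lra.
have f21 : affine_form 0 a2 (node R 1) = 0 by rewrite affine_form_node; field.
have f22 : affine_form 0 a2 (node R 2) != 0.
  have -> : affine_form 0 a2 (node R 2) = 11136 / 289.
    by rewrite affine_form_node; field.
  by lra.
have lf a k : affine_form 0 (col_mx a (0 : R)%:M) (paraboloid_lift (node R k)) =
    affine_form 0 a (node R k) by rewrite affine_form_lift mul0r addr0.
split; rewrite ?inE //.
- by move=> k l; rewrite !inE !orbF => /or3P[] /eqP -> /or3P[] /eqP ->.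
- by rewrite !imfsetU1 imfset0; exact: linearly_general_triple f10 f11 f20 f21 f22.
- rewrite !imfsetU1 !imfset0.
  by apply: (@linearly_general_triple _ _ _ _ _ 0 0 (col_mx a1 0%:M) (col_mx a2 0%:M));
    rewrite lf.
Qed.

(** A multiple k of the modulus satisfies 1 + 4k^2 = 1 modulo each of the old
    1 + 4l^2, which gives coprimality; k large gives general position. *)
Lemma admissible_extend (R : realType) (T : {fset nat}) : admissible R T ->
  exists B, forall k, (B <= k)%N -> (modulus T %| k)%N -> admissible R (k |` T)%fset.
Proof.
move=> admT; have [T0 T1 T2 copT genT genlT] := admT.
have [B1 HB1] := linearly_general_extend (@node_escapes R) genT.
have [B2 HB2] := linearly_general_extend (@lifted_node_escapes R) genlT.
exists (maxn B1 B2) => k; rewrite geq_max => /andP[lek1 lek2] Mk.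
have copk l : l \in T -> coprime (node_norm l) (node_norm k).
  move=> lT; have /dvdnP[e ->] : (node_norm l %| k)%N.
    by apply: dvdn_trans Mk; rewrite (modulus_D1 lT) dvdn_mulr.
  move: (node_norm l) => g.
  have -> : node_norm (e * g) = (4 * e ^ 2 * g * g + 1)%N.
    by rewrite /node_norm expnMn -!mulnn addnC !mulnA.
  by rewrite /coprime gcdnMDl gcdn1.
split; rewrite ?(in_fset1U, T0, T1, T2, orbT) //.
- move=> i j; rewrite !in_fset1U.
  case/orP=> [/eqP ->|iT] /orP[/eqP ->|jT]; rewrite ?eqxx // => ij.
  + by rewrite coprime_sym copk.
  + exact: copk.
  + exact: copT.
- by rewrite imfsetU1; exact: HB1.
- by rewrite !imfsetU1; exact: HB2.
Qed.

Lemma admissible_extend_large (R : realType) (T : {fset nat}) (N : nat) :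
  admissible R T -> exists k, [/\ (N <= k)%N, k \notin T & admissible R (k |` T)%fset].
Proof.
move=> admT; have [B HB] := admissible_extend admT.
(* A summand exceeding every element of [T] makes the new index fresh. *)
pose L := (N + B + (\sum_(i <- T) i).+1)%N.
have leLM : (L <= L * modulus T)%N by rewrite leq_pmulr ?modulus_gt0.
exists (L * modulus T)%N; split.
- by apply: leq_trans leLM; rewrite /L -addnA leq_addr.
- apply/negP => kT; have : (L * modulus T <= \sum_(i <- T) i)%N.
    by rewrite (big_fsetD1 _ kT) /= leq_addr.
  by apply/negP; rewrite -ltnNge; apply: leq_trans leLM; rewrite leq_addl.
- apply: HB; last by rewrite dvdn_mull.
  by apply: leq_trans leLM; rewrite /L addnAC leq_addl.
Qed.

Lemma admissible_exists (R : realType) (n : nat) : (3 <= n)%N ->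
  exists2 T, admissible R T & #|` T|%fset = n.
Proof.
elim: n => // n IHn; rewrite ltnS leq_eqVlt => /orP[/eqP <-|/IHn[T admT cT]].
  exists [fset 0; 1; 2]%fset; first exact: admissible_base.
  by rewrite fsetUC !cardfsU1 !inE cardfs1.
have [k [_ kT admk]] := admissible_extend_large 0 admT.
by exists (k |` T)%fset => //; rewrite cardfsU1 kT cT.
Qed.

(** * Similarity classes *)

(** [spread_le B P] bounds the ratio of the largest to the smallest nonzero
    distance of [P] by [B], without naming these extrema. *)
Definition spread_le (R : realType) (d : nat) (B : R) (P : {fset 'rV[R]_d}) :=
  forall x y z w, x \in P -> y \in P -> z \in P -> w \in P -> z != w ->
    edist x y <= B * edist z w.

Lemma edist_ge0 (R : realType) (d : nat) (x y : 'rV[R]_d) : 0 <= edist x y.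
Proof. exact: sqrtr_ge0. Qed.

Lemma edist_gt0 (R : realType) (d : nat) (x y : 'rV[R]_d) :
  (0 < edist x y) = (x != y).
Proof.
rewrite sqrtr_gt0 lt_def sumr_ge0 ?andbT => [|i _]; last exact: sqr_ge0.
congr (~~ _); apply/idP/eqP => [|->]; last first.
  by apply/eqP/big1 => i _; rewrite subrr expr0n.
rewrite psumr_eq0 => [/allP eq0|i _]; last exact: sqr_ge0.
apply/rowP => i; have := eq0 i (mem_index_enum i).
by rewrite sqrf_eq0 subr_eq0 => /eqP.
Qed.

Lemma le_double_sum (R : realType) (K : choiceType) (P : {fset K})
    (F : K -> K -> R) x y :
  (forall x y, 0 <= F x y) -> x \in P -> y \in P ->
  F x y <= \sum_(x <- P) \sum_(y <- P) F x y.
Proof.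
move=> F0 xP yP; rewrite (big_fsetD1 x) //= (big_fsetD1 y) //= -addrA lerDl.
by rewrite addr_ge0 ?sumr_ge0 // => i _; rewrite sumr_ge0.
Qed.

Lemma exists_spread_le (R : realType) (d : nat) (P : {fset 'rV[R]_d}) :
  exists B, spread_le B P.
Proof.
exists ((\sum_(x <- P) \sum_(y <- P) edist x y) *
        (\sum_(z <- P) \sum_(w <- P) (edist z w)^-1)) => x y z w xP yP zP wP zw.
have zw0 : 0 < edist z w by rewrite edist_gt0.
rewrite -mulrA -[leLHS]mulr1; apply: ler_pM; rewrite ?edist_ge0 //.
  exact: (le_double_sum (@edist_ge0 R d)).
rewrite -ler_pdivrMr // mul1r.
by apply: (@le_double_sum _ _ P (fun z w => (edist z w)^-1)) => // *;
  rewrite invr_ge0 edist_ge0.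
Qed.

Lemma spread_le_similar (R : realType) (d : nat) (P Q : {fset 'rV[R]_d}) (B : R) :
  are_similar P Q -> spread_le B P <-> spread_le B Q.
Proof.
move=> [f [[r [r0 fE]] <-]]; split=> sp.
  move=> _ _ _ _ /imfsetP[x /= xP ->] /imfsetP[y /= yP ->]
    /imfsetP[z /= zP ->] /imfsetP[w /= wP ->] zw.
  rewrite !fE mulrCA ler_pM2l //; apply: sp => //.
  by apply: contraNneq zw => ->.
move=> x y z w xP yP zP wP zw.
rewrite -(ler_pM2l r0) mulrCA -!fE; apply: sp; rewrite ?in_imfset //.
by rewrite -edist_gt0 fE mulr_gt0 // edist_gt0.
Qed.

Lemma spread_le_trans (R : realType) (d : nat) (P : {fset 'rV[R]_d}) (B B' : R) :
  B <= B' -> spread_le B P -> spread_le B' P.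
Proof.
move=> BB' sp x y z w xP yP zP wP zw; apply: le_trans (sp _ _ _ _ xP yP zP wP zw) _.
by rewrite ler_wpM2r ?edist_ge0.
Qed.

(** Each set of the sequence is chosen with a spread exceeding a bound on the
    spread of the preceding one; the spreads increase strictly, and spread is
    a similarity invariant. *)
Lemma infinite_dissimilar_family (R : realType) (d : nat)
    (good : {fset 'rV[R]_d} -> Prop) :
  (forall B : R, exists2 P, good P & ~ spread_le B P) ->
  exists S : set {fset 'rV[R]_d},
    [/\ infinite_set S, (forall P, S P -> good P)
      & (forall P Q, S P -> S Q -> P <> Q -> ~ are_similar P Q)].
Proof.
move=> unb.
have /choice[F FP] : forall B : R, exists P, good P /\ ~ spread_le B P.
  by move=> B; have [P gP nP] := unb B; exists P.
have /choice[G GP] := @exists_spread_le R d.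
pose b k := iter k (G \o F) 0; pose P k := F (b k).
have spS k : spread_le (b k.+1) (P k) by exact: GP.
have nsp k : ~ spread_le (b k) (P k) by exact: (FP (b k)).2.
have b_incr : {homo b : k l / (k <= l)%N >-> k <= l}.
  apply: homo_leq => // [x y z|k]; first exact: le_trans.
  rewrite leNgt; apply/negP => /ltW bk; apply: (nsp k).
  exact: spread_le_trans bk (spS k).
have sp k l : (k < l)%N -> spread_le (b l) (P k).
  by move=> /b_incr kl; exact: spread_le_trans kl (spS k).
have nsim k l : k <> l -> ~ are_similar (P k) (P l).
  move=> /eqP; rewrite neq_ltn => /orP[] /sp spk /(@spread_le_similar R d) sim.
    by apply: (nsp l); apply/sim.
  by apply: (nsp k); apply/sim.
have sim_refl Q : are_similar Q Q.
  exists id; split; first by exists 1; split=> // x y; rewrite mul1r.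
  by apply/fsetP => x; apply/imfsetP/idP => [[y ? ->]|xQ] //; exists x.
have P_inj : injective P.
  move=> k l eqP; apply: contrapT => /nsim; apply.
  by rewrite eqP; exact: sim_refl.
exists (range P); split.
- rewrite (eq_finite_set (inj_card_eq (in2W P_inj))).
  exact: infinite_nat.
- by move=> _ [k _ <-]; exact: (FP (b k)).1.
- by move=> _ _ [k _ <-] [l _ <-] kl; apply: nsim => kl'; rewrite kl' in kl.
Qed.

(** The point k is at distance at least 2k from the point 0 before scaling,
    while the points 0 and 1 are at distance 58/5. *)
Lemma spread_scaled_nodes (R : realType) (T : {fset nat}) (B : R) (k : nat) :
  0%N \in T -> 1%N \in T -> k \in T -> spread_le B (scaled_nodes R T) ->
  k%:R <= B * 29 / 5.
Proof.
move=> T0 T1 kT; set c := (modulus T)%:R / 2 : R.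
have c0 : 0 < c by rewrite divr_gt0 ?ltr0n ?modulus_gt0.
have mem l : l \in T -> c *: node R l \in scaled_nodes R T.
  by move=> lT; apply/scaled_nodesP; exists l.
move=> /(_ _ _ _ _ (mem _ T0) (mem _ kT) (mem _ T0) (mem _ T1)).
have c01 : c *: node R 0 != c *: node R 1 by apply/eqP => /scaled_node_inj.
move=> /(_ c01); rewrite !edist_scale ?(ltW c0) //.
rewrite mulrCA ler_pM2l //.
have -> : edist (node R 0) (node R 1) = 58 / 5.
  rewrite edist_curve ?mulr_ge0 // mulr0 mulr1 sub0r normrN ger0_norm //.
  by field.
have : 2 * k%:R <= edist (node R 0) (node R k).
  rewrite edist_curve ?mulr_ge0 // mulr0 sub0r normrN ger0_norm ?mulr_ge0 //.
  rewrite ler_peMr ?mulr_ge0 // lerDl.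
  by rewrite divr_ge0 ?mulr_ge0 ?addr_ge0 ?sqr_ge0 ?mulr_ge0.
lra.
Qed.

Theorem theorem1p7 (R : realType) (n : nat) (hn : (4 <= n)%N) :
  exists S : set {fset 'rV[R]_3},
    [/\ infinite_set S,
        (forall P : {fset 'rV[R]_3}, S P -> cluster n P /\ primitive P)
      & (forall P Q : {fset 'rV[R]_3}, S P -> S Q -> P <> Q -> ~ are_similar P Q)].
Proof.
apply: infinite_dissimilar_family => B.
have [T admT cT] : exists2 T, admissible R T & #|` T|%fset = n.-1.
  by apply: admissible_exists; case: n hn.
pose N := (Num.truncn (B * 29 / 5)).+1.
have [k [lek kT admk]] := admissible_extend_large N admT.
have ck : #|` (k |` T)%fset|%fset = n.
  by rewrite cardfsU1 kT cT; case: n hn {cT}.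
exists (scaled_nodes R (k |` T)%fset).
  split; last exact: primitive_scaled_nodes.
  by rewrite -ck; apply: cluster_scaled_nodes => //; rewrite ck.
move=> sp; have [T0 T1 _ _ _ _] := admk.
have := spread_scaled_nodes T0 T1 (fset1U1 k T) sp; apply/negP; rewrite -ltNge.
by apply: lt_le_trans (truncnS_gt _) _; rewrite ler_nat.
Qed.
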